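(* Let $H:=(\mathbb{Z}/2^{\eta}\mathbb{Z},+)$ be endowed with the trivial linear cycle set structure and let $I:=\mathbb{Z}/2^{r}\mathbb{Z}$, where $r>\eta+1$. Let $\diamond$ be an action of $H$ on $I$. There exists $a=\pm(1+2^{r-\eta}k)$ with $0\le k<2^{\eta}$ such that $h\diamond y=a^{h}y$. If $k\ne0$, write $k=2^{u}s$ with $0\le u<\eta$ and $2\nmid s$. In each of the following cases, the indicated set of pairs $(f_0,\gamma)$ parametrizes a complete family $(\alpha_1(\gamma),f_{f_0})$ of representatives of 2-cocycles modulo coboundaries; the formulas for $f_{f_0}$ are for $f_0$ occurring in that set. ($k=0$ and $a=1$) The set is $\{(2^{r-\eta}z_1,z_2):0\le z_1,z_2<2^{\eta}\}$. Moreover, $h\diamond y=y$ and $f_{f_0}(h,h')=f_0hh'$. ($k=0$ and $a=-1$) The set is $\{(z_1,2^{r-1}z_2+2^{\eta-1}z_1):0\le z_1,z_2<2\}$. Moreover, $h\diamond y=(-1)^{h}y$, and $f_{f_0}(h,h')=f_0h'$ if $h$ is odd, $f_{f_0}(h,h')=0$ if $h$ is even. ($k\ne0$ and $r+u>2\eta$) (a) If $a=1+2^{r-\eta}k$, the set is $\{(2^{r-\eta}(z_1-sz_2),2^{\eta-u}z_2):0\le z_1<2^{\eta}\text{ and }0\le z_2<2^{u}\}$. Moreover, $h\diamond y=(1+2^{r-\eta}kh)y$ and $f_{f_0}(h,h')=f_0hh'$. (b) If $a=-1-2^{r-\eta}k$ with $k$ even, the set is $\{(z_1+2^{r-\eta-1}kz_1,2^{r-1}z_2+2^{\eta-1}z_1):0\le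 z_1,z_2<2\}$. Moreover, $h\diamond y=(-1)^{h}(1+2^{r-\eta}kh)y$ and, for $f_0=z_1+2^{r-\eta-1}kz_1$, $f_{f_0}(h,h')=z_1h'+2^{r-\eta-1}kz_1hh'$ if $h$ is odd and $f_{f_0}(h,h')=-k2^{r-\eta-1}z_1hh'$ if $h$ is even. (c) If $a=-1-2^{r-\eta}k$ with $k$ odd, the set is $\{(0,2^{r-1}z_2):0\le z_2<2\}$. Moreover, $h\diamond y=(-1)^{h}(1+2^{r-\eta}kh)y$ and $f_{f_0}(h,h')=0$. ($k\ne0$ and $r+u\le2\eta$) (a) If $a=1+2^{r-\eta}k$, the set is $\{(2^{r-\eta}sz_1,2^{\eta-u}(z_2-z_1)):0\le z_1<2^{u}\text{ and }0\le z_2<2^{r+u-\eta}\}$. Moreover, $$h\diamond y=\sum_{i=0}^{h}\binom{h}{i}2^{(r-\eta)i}k^{i}y\quad\text{and}\quad f_{f_0}(h,h')=\sum_{l=0}^{h-1}\binom{h}{l+1}2^{(r-\eta)l}k^{l}f_0h'.$$ (b) If $a=-1-2^{r-\eta}k$ with $k$ odd, the set is $\{(0,2^{r-1}z_2):0\le z_2<2\}$. Moreover, $$h\diamond y=(-1)^{h}\sum_{i=0}^{h}\binom{h}{i}2^{(r-\eta)i}k^{i}y\quad\text{and}\quad f_{f_0}(h,h')=0.$$ (c) If $a=-1-2^{r-\eta}k$ with $k$ even, the set is $\{(z_1,2^{r-1}z_2+2^{\eta-1}cz_1):0\le z_1,z_2<2\}$, where $c:=1-2^{r-\eta-1}k$.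 Moreover, $$h\diamond y=(-1)^{h}\sum_{i=0}^{h}\binom{h}{i}2^{(r-\eta)i}k^{i}y\quad\text{and}\quad f_{f_0}(h,h')=\sum_{l=0}^{h-1}A_{hl}2^{(r-\eta)l}k^{l}f_0h',$$ where $A_{hl}:=\sum_{j=l}^{h-1}(-1)^{j}\binom{j}{l}$.
   Context: $\eta\ge1$ and $r$ are integers. The trivial linear cycle set structure on $H$ is $i\cdot j:=j$. Elements $h,h'\in H$ are identified with their integer representatives in $\{0,\dots,2^{\eta}-1\}$; integers are viewed in $I$ through their classes, so each displayed set of pairs is a subset of $I\times I$. An action of $H$ on $I$ is a map $\diamond\colon H\times I\to I$ with $(h+h')\diamond y=h\diamond(h'\diamond y)$, $h\diamond(y+y')=h\diamond y+h\diamond y'$, $0\diamond y=y$. A 2-cocycle (for $\diamond$) is a pair $(\beta,f)$ of maps $H\times H\to I$, both vanishing when some argument is $0$, with $\beta$ symmetric, such that for all $a,b,c\in H$: $\beta(b,c)-\beta(a+b,c)+\beta(a,b+c)-\beta(a,b)=0$; $f(a,b+c)-f(a,b)-f(a,c)=a\diamond\beta(b,c)-\beta(b,c)$; $f(a+b,c)=b\diamond f(a,c)+f(b,c)$. It is a coboundary if there is $t\colon H\to I$ with $t(0)=0$, $\beta(a,b)=t(a)-t(a+b)+t(b)$ and $f(a,b)=t(b)-a\diamond t(b)$ for all $a,b$. The quotient group of 2-cocycles modulo coboundaries is $\operatorname{H}^2_\diamond(H,I)$. For $\gamma\in I$ and $0\le i,j<2^{\eta}$: $\alpha_1(\gamma)(i,j):=\gamma$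 if $i+j\ge 2^{\eta}$, and $0$ otherwise. For $f_0\in I$: $f_{f_0}(h,h'):=h'\sum_{j=0}^{h-1}(j\diamond f_0)$ for $0\le h,h'<2^{\eta}$. A set $\Lambda\subseteq I\times I$ ''parametrizes a complete family $(\alpha_1(\gamma),f_{f_0})$ of representatives of 2-cocycles modulo coboundaries'' if $(\alpha_1(\gamma),f_{f_0})$ is a 2-cocycle for each $(f_0,\gamma)\in\Lambda$ and each class in $\operatorname{H}^2_\diamond(H,I)$ contains $(\alpha_1(\gamma),f_{f_0})$ for exactly one $(f_0,\gamma)\in\Lambda$. *)

(* Defs.v *)
From HB Require Import structures.
From mathcomp Require Import all_boot all_order all_fingroup all_algebra.

Set Implicit Arguments.
Unset Strict Implicit.
Unset Printing Implicit Defensive.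

Import GRing.Theory.
Local Open Scope ring_scope.

Record zaction (H I : zmodType) := ZAction {
  zact :> H -> I -> I;
  zactD : forall h h' y, zact (h + h') y = zact h (zact h' y);
  zactDr : forall h y y', zact h (y + y') = zact h y + zact h y';
  zact0 : forall y, zact 0 y = y }.

(* Pairs (beta, f) of maps H * H -> I, as a finite group under pointwise
   addition. The group multiplication of fingroup is this addition. *)
Definition cochain2 (H I : finZmodType) : Type :=
  ({ffun H * H -> I} * {ffun H * H -> I})%type.

HB.instance Definition _ (H I : finZmodType) :=
  Finite.copy (cochain2 H I) ({ffun H * H -> I} * {ffun H * H -> I})%type.
HB.instance Definition _ (H I : finZmodType) :=
  GRing.Zmodule.copy (cochain2 H I)
    ({ffun H * H -> I} * {ffun H * H -> I})%type.
HB.instance Definition _ (H I : finZmodType) :=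
  [finGroupMixin of cochain2 H I for +%R].

Section Cohomology.

Variables (H I : finZmodType) (d : zaction H I).
Implicit Types (p : cochain2 H I) (t : {ffun H -> I}).

Definition is_cocycle2 p : bool :=
  let: (beta, f) := p in
  [&& [forall a, [&& beta (a, 0) == 0, beta (0, a) == 0,
                     f (a, 0) == 0 & f (0, a) == 0]],
      [forall a, forall b, beta (a, b) == beta (b, a)],
      [forall a, forall b, forall c,
         beta (b, c) - beta (a + b, c) + beta (a, b + c) - beta (a, b) == 0],
      [forall a, forall b, forall c,
         f (a, b + c) - f (a, b) - f (a, c) == d a (beta (b, c)) - beta (b, c)]
    & [forall a, forall b, forall c,
         f (a + b, c) == d b (f (a, c)) + f (b, c)]].

Definition is_coboundary2 p : bool :=
  let: (beta, f) := p in
  [exists t : {ffun H -> I},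
     [&& t 0 == 0,
         [forall a, forall b, beta (a, b) == t a - t (a + b) + t b]
       & [forall a, forall b, f (a, b) == t b - d a (t b)]]].

Definition cocycle2 : {set cochain2 H I} := [set p | is_cocycle2 p].
Definition coboundary2 : {set cochain2 H I} := [set p | is_coboundary2 p].

Lemma zactr0 h : d h 0 = 0.
Proof. by apply: (addrI (d h 0)); rewrite -zactDr !addr0. Qed.

Lemma is_cocycle2P (beta f : {ffun H * H -> I}) :
  reflect
    [/\ forall a, [/\ beta (a, 0) = 0, beta (0, a) = 0,
                      f (a, 0) = 0 & f (0, a) = 0],
        forall a b, beta (a, b) = beta (b, a),
        forall a b c,
          beta (b, c) - beta (a + b, c) + beta (a, b + c) - beta (a, b) = 0,
        forall a b c,
          f (a, b + c) - f (a, b) - f (a, c) = d a (beta (b, c)) - beta (b, c)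
      & forall a b c, f (a + b, c) = d b (f (a, c)) + f (b, c)]
    (is_cocycle2 (beta, f)).
Proof.
apply: (iffP and5P) => -[c0 cs cb cd cf]; split.
- by move=> a; have /and4P[/eqP-> /eqP-> /eqP-> /eqP->] := forallP c0 a.
- by move=> a b; apply/eqP/(forallP (forallP cs a)).
- by move=> a b c; apply/eqP/(forallP (forallP (forallP cb a) b)).
- by move=> a b c; apply/eqP/(forallP (forallP (forallP cd a) b)).
- by move=> a b c; apply/eqP/(forallP (forallP (forallP cf a) b)).
- by apply/forallP => a; have [-> -> -> ->] := c0 a; rewrite eqxx.
- by apply/forallP => a; apply/forallP => b; rewrite cs.
- by do 3!apply/forallP => ?; rewrite cb.
- by do 3!apply/forallP => ?; rewrite cd.
- by do 3!apply/forallP => ?; rewrite cf.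
Qed.

Lemma is_coboundary2P (beta f : {ffun H * H -> I}) :
  reflect
    (exists t : H -> I,
       [/\ t 0 = 0, forall a b, beta (a, b) = t a - t (a + b) + t b
         & forall a b, f (a, b) = t b - d a (t b)])
    (is_coboundary2 (beta, f)).
Proof.
apply: (iffP existsP) => [[t /and3P[/eqP t0 tb tf]] | [t [t0 tb tf]]].
  exists t; split=> // a b; apply/eqP; first exact: (forallP (forallP tb a)).
  exact: (forallP (forallP tf a)).
exists (finfun t); apply/and3P; split; first by rewrite ffunE t0.
  by do 2!apply/forallP => ?; rewrite !ffunE tb.
by do 2!apply/forallP => ?; rewrite !ffunE tf.
Qed.

Lemma cocycle2_group_set : group_set cocycle2.
Proof.
apply/group_setP; split.
  rewrite inE; apply/(is_cocycle2P 0 0); split=> [a|a b|a b c|a b c|a b c].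
  - by rewrite !ffunE.
  - by rewrite !ffunE.
  - by rewrite !ffunE !subr0 addr0.
  - by rewrite !ffunE zactr0 !subr0.
  - by rewrite !ffunE zactr0 addr0.
move=> [b1 f1] [b2 f2]; rewrite !inE.
move=> /is_cocycle2P[p0 ps pb pd pf] /is_cocycle2P[q0 qs qb qd qf].
apply/(is_cocycle2P (b1 + b2) (f1 + f2)).
split=> [a|a b|a b c|a b c|a b c]; rewrite !ffunE.
- by have [-> -> -> ->] := p0 a; have [-> -> -> ->] := q0 a; rewrite addr0.
- by rewrite ps qs.
- rewrite !opprD (addrACA (b1 (b, c))) (addrACA (b1 _ - _)).
  by rewrite (addrACA (b1 _ - _ + _)) pb qb addr0.
- rewrite !opprD (addrACA (f1 (a, b + c))) (addrACA (f1 _ - _)).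
  by rewrite pd qd zactDr (addrACA (d a _)).
- by rewrite pf qf zactDr addrACA.
Qed.

Lemma coboundary2_group_set : group_set coboundary2.
Proof.
apply/group_setP; split.
  rewrite inE; apply/(is_coboundary2P 0 0); exists (fun=> 0).
  by split=> // a b; rewrite ffunE ?zactr0 subrr ?addr0.
move=> [b1 f1] [b2 f2]; rewrite !inE.
move=> /is_coboundary2P[t [t0 tb tf]] /is_coboundary2P[s [s0 sb sf]].
apply/(is_coboundary2P (b1 + b2) (f1 + f2)); exists (fun a => t a + s a).
split=> [|a b|a b]; first by rewrite t0 s0 addr0.
  by rewrite ffunE tb sb opprD addrACA (addrACA (t a)).
by rewrite ffunE tf sf zactDr opprD addrACA.
Qed.

Canonical cocycle2_group := Group cocycle2_group_set.
Canonical coboundary2_group := Group coboundary2_group_set.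

Lemma coboundary2_sub : coboundary2 \subset cocycle2.
Proof.
apply/subsetP => -[beta f]; rewrite !inE.
move=> /is_coboundary2P[t [t0 tb tf]]; apply/is_cocycle2P.
have dN h y : d h (- y) = - d h y.
  by apply: (addrI (d h y)); rewrite -zactDr !subrr zactr0.
split=> [a|a b|a b c|a b c|a b c].
- by rewrite !tb !tf t0 zactr0 zact0 !(addr0, add0r, subrr, addNr) oppr0.
- by rewrite !tb [b + a]addrC addrAC [RHS]addrAC [t b + t a]addrC.
- rewrite !tb; apply/eqP; rewrite subr_eq0 !opprD !opprK !addrA.
  by rewrite [eqbLHS](ACl (7*4*1*2*9*3*6*5*8)) /= subrK !addrK.
- rewrite !tb !tf !zactDr dN !opprD !opprK !addrA.
  by rewrite [RHS](ACl (5*2*4*1*6*3)).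
- by rewrite !tf zactDr dN [a + b]addrC zactD [RHS]addrC addrA subrK.
Qed.

(* By coboundary2_sub this is the actual quotient group; its elements are
   cosets, and a coset coerces to the set of cochains it contains. *)
Definition cohomology2 : {set coset_of coboundary2} :=
  (cocycle2 / coboundary2)%g.

End Cohomology.

Section Representatives.

Variables eta r : nat.
Local Notation H := 'Z_(2 ^ eta).
Local Notation I := 'Z_(2 ^ r).

Definition alpha1 (gamma : I) : {ffun H * H -> I} :=
  [ffun ij : H * H =>
     if (2 ^ eta <= val ij.1 + val ij.2)%N then gamma else 0].

Variable d : zaction H I.

Definition fcocycle (f0 : I) : {ffun H * H -> I} :=
  [ffun hh : H * H =>
     (\sum_(0 <= j < val hh.1) d j%:R f0) *+ val hh.2].

(* The elements of L are the pairs (f0, gamma). *)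
Definition parametrizes (L : {set I * I}) : Prop :=
  (forall f0 gamma, (f0, gamma) \in L ->
     (alpha1 gamma, fcocycle f0) \in cocycle2 d) /\
  (forall c : coset_of (coboundary2 d), c \in cohomology2 d ->
     exists! x : I * I, x \in L /\
       (alpha1 x.2, fcocycle x.1) \in (c : {set cochain2 H I})).

End Representatives.

(* Main.v *)
(* Put N = 2^eta. Subtracting the coboundary of t(j) = -sum_{i<j} beta(i,1)
   turns any 2-cocycle into some (alpha_1(gamma), f_{f0}). Such a pair is a
   cocycle iff N f0 = (1 - a) gamma and (sum_{j<N} a^j) f0 = 0, and a coboundary
   iff (f0, gamma) = ((1 - a) t, N t) for some t in I. So H^2 is a quotient of
   two explicit subgroups of I x I, and everything reduces to 2-adic
   bookkeeping in Z/2^r, governed by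
     sum_{j<N} (1 + 4y)^j    = N * unit,
     sum_{j<N} (-(1 + 2y))^j = -N y * unit.
   The first identity also gives the shape of a: some sign of a has the form
   b = 1 + 4y, and b^N = 1 reads (b - 1) N * unit = 0. *)
Require Import Defs.
From mathcomp Require Import all_boot all_order all_fingroup all_algebra.
From mathcomp Require Import ring zify.
Import GRing.Theory.
Local Open Scope ring_scope.

Set Implicit Arguments.
Unset Strict Implicit.
Unset Printing Implicit Defensive.

(** * Geometric sums whose length is a power of 2 *)

Lemma sumX_double (R : comPzRingType) (a : R) n :
  \sum_(0 <= j < n + n) a ^+ j = (1 + a ^+ n) * \sum_(0 <= j < n) a ^+ j.
Proof.
rewrite (@big_cat_nat _ _ _ n) ?leq_addr //= mulrDl mul1r; congr (_ + _).
rewrite -{1}[n]add0n big_addn addnK mulr_sumr.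
by apply: eq_bigr => j _; rewrite exprD mulrC.
Qed.

(** Doubling the length multiplies the sum by [1 + a ^+ (2 ^ n)]. Powers of [1 + 4 * y] keep that
    shape, so each doubling contributes a factor of the form [2 * (1 + 2 * z)]. *)
Lemma sumX_1mod4 (R : comPzRingType) (y : R) n :
  exists w, \sum_(0 <= j < 2 ^ n) (1 + 4 * y) ^+ j = 2 ^+ n * (1 + 2 * w).
Proof.
have X4 m : exists z, (1 + 4 * y) ^+ m = 1 + 4 * z.
  elim: m => [|m [z IH]]; first by exists 0; rewrite mulr0 addr0.
  by exists (y + z + 4 * y * z); rewrite exprS IH; ring.
elim: n => [|n [w IH]]; first by exists 0; rewrite big_nat1; ring.
have [z zE] := X4 (2 ^ n)%N.
rewrite expnS mul2n -addnn sumX_double IH zE.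
by exists (w + z + 2 * w * z); rewrite exprS; ring.
Qed.

Lemma sumX_even (R : comPzRingType) (a : R) n :
  \sum_(0 <= j < n.*2) a ^+ j = (1 + a) * \sum_(0 <= j < n) (a ^+ 2) ^+ j.
Proof.
elim: n => [|n IH]; first by rewrite !big_nil mulr0.
rewrite doubleS !big_nat_recr //= IH -[n.*2]mul2n [a ^+ (2 * n).+1]exprS !exprM.
by ring.
Qed.

(** Pairing consecutive terms extracts [1 + a = - (2 * y)] and leaves a sum of 2^(n-1) powers of
    [a ^+ 2 = 1 + 4 * (y + y ^+ 2)], to which [sumX_1mod4] applies. *)
Lemma sumX_N1mod2 (R : comPzRingType) (y : R) n : (0 < n)%N ->
  exists w, \sum_(0 <= j < 2 ^ n) (- (1 + 2 * y)) ^+ j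
            = - (2 ^+ n * y * (1 + 2 * w)).
Proof.
case: n => // n _.
have [w wE] := @sumX_1mod4 R (y + y ^+ 2) n; exists w.
rewrite expnS mul2n sumX_even.
have -> : (- (1 + 2 * y)) ^+ 2 = 1 + 4 * (y + y ^+ 2) by ring.
by rewrite wE exprS; ring.
Qed.

(** * Divisibility by powers of 2 in Z/2^r *)

Section Mod2r.
Variables (r : nat) (r_gt0 : (0 < r)%N).
Local Notation I := 'Z_(2 ^ r).

Lemma Zp2_gt1 : (1 < 2 ^ r)%N.
Proof. by rewrite -{1}(expn0 2) ltn_exp2l. Qed.

Lemma natr_Z2 (y : I) : (val y)%:R = y.
Proof. exact: natr_Zp. Qed.

Lemma ltn_Z2 (y : I) : (val y < 2 ^ r)%N.
Proof.
by have := ltn_ord y; rewrite [X in (_ < X)%N -> _](Zp_cast Zp2_gt1).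
Qed.

Lemma eqr_nat_Z2 (m n : nat) : (m%:R == n%:R :> I) = (m == n %[mod 2 ^ r])%N.
Proof. by rewrite -val_eqE /= !val_Zp_nat ?Zp2_gt1. Qed.

Lemma expr2_Z2_eq0 m : (r <= m)%N -> (2 : I) ^+ m = 0.
Proof.
move=> /subnK <-; rewrite exprD -[_ ^+ r]natrX.
by rewrite pchar_Zp ?mulr0 ?Zp2_gt1.
Qed.

(** On representatives the hypothesis says that 2^r divides 2^i times [val y], and 2^i cancels. This
    replaces division by 2^i in [I]. *)
Lemma mulX2_eq0 i (y : I) : (i <= r)%N -> 2 ^+ i * y = 0 ->
  exists w, y = 2 ^+ (r - i) * w.
Proof.
move=> le_ir /eqP; rewrite -(natr_Z2 y) -natrX -natrM -[0]/(0%:R) eqr_nat_Z2.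
rewrite mod0n -/(dvdn _ _) -{1}(subnKC le_ir) expnD dvdn_pmul2l ?expn_gt0 //.
by move=> /dvdnP[q ->]; exists q%:R; rewrite natrM natrX mulrC.
Qed.

(** Division of the representative with remainder. The remainder serves as the normal form of a
    coordinate modulo 2^i, and [natr_inj_modX2] gives its uniqueness. *)
Lemma divX2 i (y : I) : exists q z : nat, (z < 2 ^ i)%N /\
  y = z%:R + 2 ^+ i * q%:R.
Proof.
exists (val y %/ 2 ^ i)%N, (val y %% 2 ^ i)%N.
split; first by rewrite ltn_mod expn_gt0.
by rewrite -natrX -natrM -natrD addnC mulnC -divn_eq natr_Z2.
Qed.

Lemma natr_inj_modX2 i (z z' : nat) (w : I) : (i <= r)%N ->
  (z < 2 ^ i)%N -> (z' < 2 ^ i)%N -> z%:R = z'%:R + 2 ^+ i * w -> z = z'.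
Proof.
move=> le_ir zi z'i /eqP; rewrite -(natr_Z2 w) -natrX -natrM -natrD eqr_nat_Z2.
move=> /eqP/(congr1 (modn^~ (2 ^ i)%N)) /=.
by rewrite !modn_dvdm ?dvdn_exp2l // addnC mulnC modnMDl !modn_small.
Qed.

Lemma odd_unit_Z2 (s : nat) : odd s -> (s%:R : I) \is a GRing.unit.
Proof. by move=> s_odd; rewrite unitZpE ?Zp2_gt1 // coprimeXl // coprime2n. Qed.

Lemma unit_1D2 (y : I) : (1 + 2 * y) \is a GRing.unit.
Proof.
rewrite -(natr_Z2 y) -natrM -[1]/(1%:R) -natrD.
by apply: odd_unit_Z2; rewrite mul2n /= odd_double.
Qed.

End Mod2r.

(** * Cocycles and coboundaries among the pairs [(alpha1 eta g, fcocycle d f0)] *)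

Lemma zactB (H I : zmodType) (d : zaction H I) h (y z : I) :
  d h (y - z) = d h y - d h z.
Proof. by apply/eqP; rewrite -subr_eq opprK -zactDr subrK. Qed.

Lemma zactMn (H I : finZmodType) (d : zaction H I) h (y : I) n :
  d h (y *+ n) = d h y *+ n.
Proof.
elim: n => [|n IH]; first by rewrite !mulr0n zactr0.
by rewrite !mulrSr zactDr IH.
Qed.

Section Cocycles.

Variables (eta r : nat) (eta_gt0 : (0 < eta)%N).
Local Notation H := 'Z_(2 ^ eta).
Local Notation I := 'Z_(2 ^ r).
Local Notation N := (2 ^ eta)%N.
Variable d : zaction H I.

Let N_gt1 : (1 < N)%N := Zp2_gt1 eta_gt0.

(** Both representatives are below N, so at most one N is removed. The test for this carry is the
    one in [alpha1]. *)
Lemma Z2_addE (a b : H) :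
  val (a + b) = (if N <= val a + val b then val a + val b - N
                 else val a + val b)%N.
Proof.
have -> : val (a + b) = ((val a + val b) %% N)%N.
  by rewrite -[in LHS](natr_Z2 a) -[in LHS](natr_Z2 b) -natrD [LHS]val_Zp_nat.
have ? := ltn_Z2 eta_gt0 a; have ? := ltn_Z2 eta_gt0 b; case: leqP => ?;
  last first.
  by rewrite modn_small.
by rewrite -[X in (X %% _)%N](@subnK N) // modnDr modn_small //; lia.
Qed.

Lemma Z2_val1 : val (1 : H) = 1%N.
Proof. by rewrite -[1 : H]/(1%:R : H) [LHS]val_Zp_nat ?modn_small. Qed.

(** With the carry as a 0/1 multiplier, identities for [alpha1] become identities between numbers of
    carries. *)
Lemma alpha1E g (i j : H) :
  alpha1 eta g (i, j) = g *+ (N <= val i + val j)%N :> I.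
Proof. by rewrite ffunE /=; case: leqP. Qed.

(** Indexed by natural numbers rather than by [H], so that induction applies and the wrap-around
    becomes the separate condition [orbit_sum f0 N = 0]. *)
Definition orbit_sum (f0 : I) (n : nat) : I := \sum_(0 <= j < n) d j%:R f0.

Lemma fcocycleE f0 (h h' : H) :
  fcocycle d f0 (h, h') = orbit_sum f0 (val h) *+ val h'.
Proof. by rewrite ffunE. Qed.

Lemma orbit_sumS f0 n : orbit_sum f0 n.+1 = orbit_sum f0 n + d n%:R f0.
Proof. exact: big_nat_recr. Qed.

Lemma orbit_sum1 f0 : orbit_sum f0 1 = f0.
Proof. by rewrite /orbit_sum big_nat1 zact0. Qed.

Lemma orbit_sumD f0 m n :
  orbit_sum f0 (m + n) = d n%:R (orbit_sum f0 m) + orbit_sum f0 n.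
Proof.
elim: m => [|m IH]; first by rewrite [orbit_sum f0 0]big_nil zactr0 add0r.
by rewrite addSn !orbit_sumS zactDr IH [in RHS]addrAC -zactD natrD [m%:R +
  _]addrC.
Qed.

Lemma orbit_sum_subr (t : I) n : orbit_sum (t - d 1 t) n = t - d n%:R t.
Proof.
elim: n => [|n IH]; first by rewrite [LHS]big_nil zact0 subrr.
by rewrite orbit_sumS IH zactB -zactD addrA subrK -natr1.
Qed.

Lemma orbit_sumMn (f0 : I) n m : orbit_sum (f0 *+ m) n = orbit_sum f0 n *+ m.
Proof. by rewrite /orbit_sum -sumrMnl; apply: eq_bigr => j _;
  rewrite zactMn. Qed.

Lemma orbit_sumB (f0 f1 : I) n :
  orbit_sum (f0 - f1) n = orbit_sum f0 n - orbit_sum f1 n.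
Proof. by rewrite /orbit_sum -sumrB; apply: eq_bigr => j _; rewrite zactB. Qed.

Lemma alpha1B (g g' : I) : alpha1 eta (g - g') = alpha1 eta g - alpha1 eta g'.
Proof.
by apply/ffunP => -[i j]; rewrite !ffunE /=; case: ifP; rewrite ?subrr.
Qed.

Lemma fcocycleB (f0 f1 : I) :
  fcocycle d (f0 - f1) = fcocycle d f0 - fcocycle d f1.
Proof.
apply/ffunP => -[i j]; rewrite !ffunE /=.
by rewrite -!/(orbit_sum _ _) orbit_sumB mulrnBl.
Qed.

Definition rep_cond (f0 g : I) : Prop :=
  f0 *+ N = g - d 1 g /\ orbit_sum f0 N = 0.

(** Both conditions come from evaluating the two identities for f at the wrap-around 1 + (N - 1) =
    0. Conversely, the first one telescopes to a formula for N times any orbit sum, and the second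
    lets orbit sums descend to [H]. *)
Lemma rep_cocycleP f0 g :
  (alpha1 eta g, fcocycle d f0) \in cocycle2 d <-> rep_cond f0 g.
Proof.
have v1 := Z2_val1.
have vN : val (N.-1%:R : H) = N.-1.
  by rewrite [LHS]val_Zp_nat ?modn_small // prednK // ltnW.
rewrite inE; split.
  move=> /is_cocycle2P[_ _ _ C4 C5].
  have N0 : (N.-1%:R + 1 : H) = 0 by rewrite natr1 prednK ?pchar_Zp // ltnW.
  split.
    have := C4 1 N.-1%:R 1; rewrite N0 alpha1E !fcocycleE v1 vN orbit_sum1.
    rewrite addn1 prednK ?(ltnW N_gt1) // leqnn mulr0n sub0r.
    rewrite -[f0 *+ 1]/f0 -opprD -mulrSr prednK ?(ltnW N_gt1) //.
    by move=> /(congr1 -%R); rewrite opprK opprB.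
  have := C5 1 N.-1%:R 1;
    rewrite [1 + _]addrC N0 !fcocycleE v1 vN orbit_sum1 /=.
  rewrite [orbit_sum f0 0]big_nil mul0rn !mulr1n addrC -orbit_sumS.
  by rewrite prednK ?(ltnW N_gt1) // => /esym.
case=> fN sN; apply/is_cocycle2P.
have fhN n : orbit_sum f0 n *+ N = g - d n%:R g.
  by rewrite -orbit_sumMn fN orbit_sum_subr.
have vlt := ltn_Z2 eta_gt0.
have sD (a b : H) : orbit_sum f0 (val (a + b)) = orbit_sum f0 (val a + val b).
  rewrite Z2_addE; case: leqP => // le_N.
  by rewrite -[in RHS](subnK le_N) orbit_sumD pchar_Zp // zact0 sN addr0.
split=> [a|a b|a b c|a b c|a b c].
- rewrite !alpha1E !fcocycleE /= addn0 add0n leqNgt vlt mulr0n.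
  by rewrite [orbit_sum f0 0]big_nil mul0rn.
- by rewrite !alpha1E addnC.
- rewrite !alpha1E !Z2_addE.
  have := vlt a; have := vlt b; have := vlt c.
  move: (val a) (val b) (val c) => i j k ? ? ?.
  (* Each side counts the carries made in forming i + j + k, once for each bracketing. *)
  have : ((N <= j + k) + (N <= i + (if N <= j + k then j + k - N else j + k)) =
    (N <= (if N <= i + j then i + j - N else i + j) + k) + (N <= i + j))%N.
    by case: (leqP N (j + k)); case: (leqP N (i + j)) => ? ?; lia.
  by move=> E;
    rewrite [_ - _ + _]addrAC -mulrnDr -addrA -opprD -mulrnDr E subrr.
- rewrite !fcocycleE alpha1E Z2_addE.
  have gE : d a g - g = - (orbit_sum f0 (val a) *+ N) by rewrite fhN natr_Z2
    opprB.
  case: leqP => le_N;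
    last by rewrite mulr0n zactr0 subrr -addrA -opprD -mulrnDr subrr.
  by rewrite mulr1n gE -addrA -opprD -mulrnDr mulrnBr // addrAC subrr sub0r.
- rewrite !fcocycleE sD orbit_sumD natr_Z2 zactMn mulrnDl //.
Qed.

(** Without a carry [alpha1] vanishes, so t(n) = n t(1) for n < N; the carry at (N - 1) + 1 then
    yields g = N t(1). Conversely, t(j) = j t is a primitive. *)
Lemma rep_coboundaryP f0 g :
  (alpha1 eta g, fcocycle d f0) \in coboundary2 d <->
  exists t, f0 = t - d 1 t /\ g = t *+ N.
Proof.
have v1 := Z2_val1.
rewrite inE; split.
  move=> /is_coboundary2P[t [t0 tb tf]]; exists (t 1).
  split; first by rewrite -tf fcocycleE v1 orbit_sum1.
  have tn n : (n < N)%N -> t n%:R = t 1 *+ n.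
    elim: n => // n IH lt_n.
    have vn : val (n%:R : H) = n by rewrite [LHS]val_Zp_nat ?modn_small // ltnW.
    have := tb n%:R 1; rewrite alpha1E vn v1 addn1 leqNgt lt_n mulr0n natr1.
    rewrite IH ?(ltnW lt_n) // => /eqP.
    by rewrite addrAC eq_sym subr_eq0 -mulrSr => /eqP.
  have vN : val (N.-1%:R : H) = N.-1.
    by rewrite [LHS]val_Zp_nat ?modn_small // prednK // ltnW.
  have := tb N.-1%:R 1;
    rewrite alpha1E vN v1 addn1 natr1 prednK ?(ltnW N_gt1) //.
  rewrite leqnn pchar_Zp // t0 subr0 tn ?prednK ?(ltnW N_gt1) // mulr1n => ->.
  by rewrite -mulrSr prednK ?(ltnW N_gt1).
case=> t [-> ->]; apply/is_coboundary2P; exists (fun j => t *+ val j).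
split=> // a b.
  rewrite alpha1E Z2_addE; case: leqP => le_N; rewrite addrAC -mulrnDr.
    by rewrite mulrnBr // opprB addrC subrK.
  by rewrite subrr.
by rewrite fcocycleE orbit_sum_subr natr_Z2 mulrnBl zactMn.
Qed.

(* [t] kills [beta (j, 1)] for [j < N - 1]; the cocycle identity then forces
   [beta - delta t = alpha1 g] by induction on the second argument. *)
Lemma cocycle_repr (p : cochain2 H I) : p \in cocycle2 d ->
  exists f0 g, p - (alpha1 eta g, fcocycle d f0) \in coboundary2 d.
Proof.
case: p => beta f; rewrite inE => Cp.
have /is_cocycle2P[C1 C2 C3 _ _] := Cp.
pose t (a : H) : I := - \sum_(0 <= i < val a) beta (i%:R, 1).
pose beta' : {ffun H * H -> I} :=
  [ffun ab => beta ab - (t ab.1 - t (ab.1 + ab.2) + t ab.2)].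
pose f' : {ffun H * H -> I} := [ffun ab => f ab - (t ab.2 - d ab.1 (t ab.2))].
have Bt : ([ffun ab : H * H => t ab.1 - t (ab.1 + ab.2) + t ab.2],
           [ffun ab : H * H => t ab.2 - d ab.1 (t ab.2)]) \in coboundary2 d.
  rewrite inE; apply/is_coboundary2P; exists t.
  by split=> [|a b|a b]; rewrite ?ffunE // /t big_nil oppr0.
have subE : ((beta, f) : cochain2 H I) - (beta', f') =
    ([ffun ab : H * H => t ab.1 - t (ab.1 + ab.2) + t ab.2],
     [ffun ab : H * H => t ab.2 - d ab.1 (t ab.2)]).
  by congr (_, _); apply/ffunP => ab; rewrite !ffunE subKr.
have Zp' : (beta', f') \in cocycle2 d.
  rewrite -[(beta', f')](subKr ((beta, f) : cochain2 H I)) subE.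
  apply: (@groupM _ (cocycle2_group d)); first by rewrite inE.
  by apply: groupVr; apply: (subsetP (coboundary2_sub d)).
suff [g [f0 [bE fE]]] : exists g f0, beta' = alpha1 eta g /\ f' = fcocycle d f0.
  by exists f0, g; rewrite -bE -fE subE.
have v1 := Z2_val1; have vlt := ltn_Z2 eta_gt0.
have vn n : (n < N)%N -> val (n%:R : H) = n.
  by move=> ?; rewrite [LHS]val_Zp_nat ?modn_small.
move: Zp'; rewrite inE => /is_cocycle2P[D1 D2 D3 D4 D5].
have b1 n : (n.+1 < N)%N -> beta' (n%:R, 1) = 0.
  move=> lt_n; rewrite ffunE /= /t v1 big_nat1 natr1 !vn ?(ltnW lt_n) //.
  have [_ -> _ _] := C1 1.
  by rewrite big_nat_recr //= opprK oppr0 addr0 addKr subrr.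
have NE : N.-1.+1 = N by rewrite prednK ?(ltnW N_gt1).
pose g := beta' (N.-1%:R, 1); exists g.
have bcE c : beta' (c, 1) = g *+ (val c == N.-1).
  rewrite -[in LHS](natr_Z2 c); case: eqP => [-> //|/eqP neq_c].
  by rewrite b1 //; move: (val c) (vlt c) neq_c => m; lia.
have bE a b : beta' (a, b) = alpha1 eta g (a, b).
  rewrite -[b]natr_Z2; move: (vlt b); move: (val b) => n.
  elim: n => [|n IH] lt_n.
    by have [-> _ _ _] := D1 a; rewrite alpha1E addn0 leqNgt vlt.
  have := D3 a n%:R 1; rewrite natr1 b1 // sub0r IH ?(ltnW lt_n) //.
  rewrite addrAC -opprD addrC => /eqP; rewrite subr_eq0 => /eqP ->.
  rewrite bcE !alpha1E Z2_addE !vn ?(ltnW lt_n) // -mulrnDr; congr (_ *+ _).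
  have := vlt a; move: (val a) => m lt_m.
  by case: (leqP N (m + n)) => ?; lia.
exists (f' (1, 1)); split; apply/ffunP => -[a b]; first exact: bE.
rewrite fcocycleE.
(* As [beta'] vanishes at (n, 1) before the carry, [f'] is additive in its second argument there.
   The remaining values [f' (a, 1)] follow from the crossed identity in the first argument. *)
have -> : f' (a, b) = f' (a, 1) *+ val b.
  rewrite -[in LHS](natr_Z2 b); move: (vlt b); move: (val b) => n.
  elim: n => [|n IH] lt_n; first by have [_ _ -> _] := D1 a.
  have := D4 a n%:R 1; rewrite natr1 b1 // zactr0 subrr IH ?(ltnW lt_n) //.
  by rewrite -addrA -opprD -mulrSr => /eqP; rewrite subr_eq0 => /eqP.
congr (_ *+ _); rewrite -[in LHS](natr_Z2 a); elim: (val a) => [|n IH].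
  by have [_ _ _ ->] := D1 1; rewrite /orbit_sum big_nil.
by rewrite orbit_sumS -natr1 addrC D5 IH addrC.
Qed.

(** [alpha1] and [fcocycle] are additive, so two representatives are cohomologous exactly when their
    parameters differ by some [(t - d 1 t, t *+ N)]. This turns the statement on cosets into one on
    pairs. *)
Lemma parametrizesI (L : {set I * I}) :
  (forall f0 g, (f0, g) \in L -> rep_cond f0 g) ->
  (forall f0 g, rep_cond f0 g ->
     exists t, (f0 + (t - d 1 t), g + t *+ N) \in L) ->
  (forall f0 g f1 g', (f0, g) \in L -> (f1, g') \in L ->
     forall t, f0 = f1 + (t - d 1 t) -> g = g' + t *+ N ->
     (f0, g) = (f1, g')) ->
  parametrizes d L.
Proof.
move=> LZ Lex Luniq; split=> [f0 g /LZ|c]; first by rewrite rep_cocycleP.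
case/morphimP => p Np Zp ->.
have inP (q : cochain2 H I) : (q \in (coset (coboundary2 d) p : {set _})) =
    (q - p \in coboundary2 d).
  by rewrite val_coset // mem_rcoset.
pose rep f0 g : cochain2 H I := (alpha1 eta g, fcocycle d f0).
have repB f0 g f1 g' : rep (f0 - f1) (g - g') = rep f0 g - rep f1 g'.
  by rewrite /rep alpha1B fcocycleB.
have BB (q q' : cochain2 H I) : q \in coboundary2 d -> q' \in coboundary2 d ->
    q - q' \in coboundary2 d.
  by move=> Bq Bq'; apply: (@groupM _ (coboundary2_group d) q (- q')) => //;
    apply: groupVr.
have ZB (q q' : cochain2 H I) : q \in cocycle2 d -> q' \in cocycle2 d ->
    q - q' \in cocycle2 d.
  by move=> Bq Bq'; apply: (@groupM _ (cocycle2_group d) q (- q')) => //;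
    apply: groupVr.
have [f0 [g Bp]] := cocycle_repr Zp.
rewrite -/(rep f0 g) in Bp.
have /rep_cocycleP Zfg : rep f0 g \in cocycle2 d.
  rewrite -[rep f0 g](subKr p).
  by apply: ZB => //; apply: (subsetP (coboundary2_sub d)).
have [t Lt] := Lex _ _ Zfg.
exists (f0 + (t - d 1 t), g + t *+ N); split.
  split=> //; rewrite inP /= -/(rep _ _).
  have Bt : rep (t - d 1 t) (t *+ N) \in coboundary2 d.
    by apply/rep_coboundaryP; exists t.
  suff -> : rep (f0 + (t - d 1 t)) (g + t *+ N) - p
          = rep (t - d 1 t) (t *+ N) - (p - rep f0 g) by apply: BB.
  rewrite -[in RHS](addrK f0 (t - _)) -[in RHS](addrK g (t *+ N)) repB.
  by rewrite opprB [_ + (rep f0 g - p)]addrA subrK [t *+ N + g]addrC [t - _ +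
    f0]addrC.
move=> [f1 g'] [L1]; rewrite inP /= -/(rep _ _) => B1.
have : rep f0 g - rep f1 g' \in coboundary2 d.
  rewrite (_ : _ - _ = - (p - rep f0 g) - (rep f1 g' - p)).
    by apply: (BB) => //; apply: groupVr.
  by rewrite !opprB addrA subrK.
rewrite -repB => /rep_coboundaryP[s [sf sg]].
apply: (Luniq _ _ _ _ Lt L1 (s + t)).
  by rewrite zactDr opprD addrACA -sf [RHS]addrA (subrKC f1).
by rewrite mulrnDl -sg [RHS]addrA (subrKC g').
Qed.

End Cocycles.

(** * The conditions on pairs when the action is multiplication by powers of [a] *)

Section Action.

Variables (eta r : nat) (eta_gt0 : (0 < eta)%N) (lt_eta : (eta + 1 < r)%N).
Local Notation H := 'Z_(2 ^ eta).
Local Notation I := 'Z_(2 ^ r).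
Local Notation N := (2 ^ eta)%N.
Variables (d : zaction H I) (a : I).
Hypothesis dE : forall (h : H) (y : I), d h y = a ^+ h * y.

Let r_gt0 : (0 < r)%N. Proof. by move: lt_eta; case: (r). Qed.

Lemma zact1E (y : I) : d 1 y = a * y.
Proof. by rewrite dE (Z2_val1 eta_gt0). Qed.

Lemma zact_natE n (y : I) : d n%:R y = a ^+ n * y.
Proof.
elim: n => [|n IH]; first by rewrite zact0 mul1r.
by rewrite -natr1 addrC zactD zact1E IH exprS mulrA.
Qed.

Lemma expr_base : a ^+ N = 1.
Proof. by rewrite -[LHS]mulr1 -zact_natE pchar_Zp ?zact0 // Zp2_gt1. Qed.

Lemma orbit_sumE f0 n : orbit_sum d f0 n = (\sum_(0 <= j < n) a ^+ j) * f0.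
Proof. by rewrite mulr_suml; apply: eq_bigr => j _; rewrite zact_natE. Qed.

Lemma fcocycle_mulE f0 (h h' : H) :
  fcocycle d f0 (h, h') = (\sum_(0 <= j < val h) a ^+ j) * f0 * (val h')%:R.
Proof. by rewrite fcocycleE orbit_sumE mulr_natr. Qed.

Lemma parametrizes_mulI (L : {set I * I}) :
  (forall f0 g, (f0, g) \in L -> 2 ^+ eta * f0 = (1 - a) * g /\
     (\sum_(0 <= j < N) a ^+ j) * f0 = 0) ->
  (forall f0 g, 2 ^+ eta * f0 = (1 - a) * g ->
     (\sum_(0 <= j < N) a ^+ j) * f0 = 0 ->
     exists t, (f0 + (1 - a) * t, g + 2 ^+ eta * t) \in L) ->
  (forall f0 g f1 g', (f0, g) \in L -> (f1, g') \in L ->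
     forall t, f0 = f1 + (1 - a) * t -> g = g' + 2 ^+ eta * t ->
     (f0, g) = (f1, g')) ->
  parametrizes d L.
Proof.
have repE f0 g : rep_cond d f0 g <-> 2 ^+ eta * f0 = (1 - a) * g /\
     (\sum_(0 <= j < N) a ^+ j) * f0 = 0.
  by rewrite /rep_cond orbit_sumE zact1E -[f0 *+ N]mulr_natl natrX mulrBl mul1r.
have bE t : t - d 1 t = (1 - a) * t by rewrite zact1E mulrBl mul1r.
have NE (t : I) : t *+ N = 2 ^+ eta * t by rewrite -natrX mulr_natl.
move=> L1 L2 L3;
  apply: parametrizesI => // [f0 g /L1/repE //|f0 g /repE[]|f0 g f1 g' L0 L0'
  t].
  by move=> fN fS; have [t Lt] := L2 _ _ fN fS; exists t; rewrite bE NE.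
by rewrite bE NE; apply: L3 L0 L0' t.
Qed.

(** * The sign minus: [1 - a] is 2 times a unit *)

Section Minus.
Variable x : I.
Hypothesis aE : a = - (1 + 2 * x).

Let a1 : 1 - a = 2 * (1 + x). Proof. by rewrite aE; ring. Qed.

Let two_half : 2 * 2 ^+ (r - 1) = 0 :> I.
Proof. by rewrite -exprS -subSn // subSS subn0 expr2_Z2_eq0. Qed.

Let half (y : I) : 2 * y = 0 -> exists z, (z < 2)%N /\ y = 2 ^+ (r - 1) * z%:R.
Proof.
move=> /(@mulX2_eq0 _ r_gt0 1 _ r_gt0)[w ->].
have [q [z [z2 ->]]] := divX2 1 w; exists z; split=> //.
by rewrite mulrDr [X in _ + X]mulrA -exprD subnK // (expr2_Z2_eq0 r_gt0 (leqnn
  r)) mul0r addr0.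
Qed.

(* In the theorem [x = 2 ^ (r - eta - 1) * k], so the first hypothesis says
   that [k] is even. *)
Lemma parametrizes_minus_even (F G : nat -> I) :
  x *+ 2 ^ eta = 0 -> (1 + x) \is a GRing.unit ->
  (forall z, exists w, F z = z%:R + 2 * w) ->
  (forall z, (z < 2)%N -> 2 ^+ eta * F z = (1 - a) * G z) ->
  parametrizes d [set (F (val z1), 2 ^+ (r - 1) * (val z2)%:R + G (val z1))
                   | z1 : 'I_2, z2 : 'I_2].
Proof.
move=> x0 ux F2 FG.
(* The sum is a multiple of N x, so every [f0] satisfies the second cocycle condition. *)
have S0 : \sum_(0 <= j < N) a ^+ j = 0.
  have [w] := sumX_N1mod2 x eta_gt0; rewrite -aE => ->.
  by rewrite -natrX mulr_natl x0 mul0r oppr0.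
apply: parametrizes_mulI => [f0 g|f0 g fg _|f0 g f1 g'].
- case/imset2P=> z1 z2 _ _ [-> ->]; rewrite S0 mul0r; split=> //.
  by rewrite mulrDr -FG // a1 [X in X + _]mulrAC mulrA two_half !mul0r add0r.
- have [q [z1 [lt_z1 f0E]]] := divX2 1 f0; rewrite expr1 in f0E.
  have [w Fz1] := F2 z1.
  (* Here [f0] and [F z1] agree modulo 2, and [t] solves [(1 - a) * t = F z1 - f0], since
     [1 - a = 2 * (1 + x)]. *)
  pose t := (1 + x)^-1 * (w - q%:R).
  have tE : f0 + (1 - a) * t = F z1.
    by rewrite a1 /t -mulrA mulVKr // f0E Fz1; ring.
  (* Once the first component is [F z1], the second differs from [G z1] by an element killed by
     [1 - a], hence by 2. *)
  have [|z2 [lt_z2 gE]] := @half (g + 2 ^+ eta * t - G z1).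
    apply/eqP; rewrite -(mulrI_eq0 _ (mulrI ux)) mulrCA mulrA -a1 mulrBr mulrDr.
    by rewrite -fg mulrCA -mulrDr tE FG // subrr.
  exists t; rewrite tE; apply/imset2P.
  by exists (Ordinal lt_z1) (Ordinal lt_z2); rewrite ?inE //= -gE subrK.
- case/imset2P=> z1 z2 _ _ [-> ->]; case/imset2P=> z1' z2' _ _ [-> ->] t tf tg.
  have [w Fz1] := F2 z1; have [w' Fz1'] := F2 z1'.
  have z1E : val z1 = val z1'.
    apply: (@natr_inj_modX2 _ r_gt0 1 _ _ (w' - w + (1 + x) * t) r_gt0 (ltn_ord
      z1) (ltn_ord z1')).
    move: tf; rewrite Fz1 Fz1' a1 => E.
    by rewrite -[LHS](addrK (2 * w)) [X in X - _]E; ring.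
  have /half[z [_ tE]] : 2 * t = 0.
    apply/eqP; rewrite -(mulrI_eq0 _ (mulrI ux)) mulrCA mulrA -a1.
    by move: tf; rewrite z1E -[LHS]addr0 => /addrI <-.
  have t0 : 2 ^+ eta * t = 0.
    by rewrite tE mulrA -exprD expr2_Z2_eq0 ?mul0r //; lia.
  by rewrite tg t0 addr0 z1E.
Qed.

(** Now the geometric sum equals -2^(r-1), which kills exactly the even [f0]. These are the
    multiples of [1 - a], so [f0] can be moved to 0, and then 2 kills the second component. *)
Lemma parametrizes_minus_odd :
  2 ^+ eta * x = 2 ^+ (r - 1) -> (1 + x) \is a GRing.unit ->
  parametrizes d [set (0, 2 ^+ (r - 1) * (val z2)%:R) | z2 : 'I_2].
Proof.
move=> x1 ux.
apply: parametrizes_mulI => [f0 g|f0 g fg|f0 g f1 g'].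
- case/imsetP=> z _ [-> ->]; rewrite !mulr0; split=> //.
  by rewrite a1 mulrAC mulrA two_half !mul0r.
- have [w] := sumX_N1mod2 x eta_gt0; rewrite -aE x1 => ->.
  rewrite mulrDr mulr1 [_ * (2 * w)]mulrCA mulrA two_half mul0r addr0 mulNr =>
    /eqP; rewrite oppr_eq0 => /eqP.
  move=> /(@mulX2_eq0 _ r_gt0 _ _ (leq_subr 1 r))[q f0E].
  rewrite subKn // expr1 in f0E.
  pose t := - ((1 + x)^-1 * q).
  have tE : f0 + (1 - a) * t = 0.
    by rewrite a1 /t mulrN -mulrA mulVKr // f0E subrr.
  have [|z2 [lt_z2 gE]] := @half (g + 2 ^+ eta * t).
    apply/eqP; rewrite -(mulrI_eq0 _ (mulrI ux)) mulrCA mulrA -a1 mulrDr.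
    by rewrite -fg mulrCA -mulrDr tE mulr0.
  exists t; rewrite tE; apply/imsetP.
  by exists (Ordinal lt_z2); rewrite ?inE //= gE.
- case/imsetP=> z2 _ [-> ->]; case/imsetP=> z2' _ [-> ->] t tf tg.
  have /half[z [_ tE]] : 2 * t = 0.
    by apply/eqP; rewrite -(mulrI_eq0 _ (mulrI ux)) mulrCA mulrA -a1 tf add0r.
  have t0 : 2 ^+ eta * t = 0.
    by rewrite tE mulrA -exprD expr2_Z2_eq0 ?mul0r //; lia.
  by rewrite tg t0 addr0.
Qed.

End Minus.

(** * The sign plus *)

(* The disjunct [u == eta] covers the trivial action [a = 1]. *)
Section Plus.
Variables u s : nat.
Hypotheses (le_u : (u <= eta)%N) (s_odd : odd s || (u == eta)).
Hypothesis aE : a = 1 + 2 ^+ (r - eta) * (2 ^+ u * s%:R).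

(** Since r - eta >= 2, [a] is 1 modulo 4 and the geometric sum is N times a unit. So N f0 = 0, and
    the first condition becomes (1 - a) g = 0, where 1 - a is -2^(r-eta+u) s. *)
Lemma plus_condP f0 g :
  2 ^+ eta * f0 = (1 - a) * g /\ (\sum_(0 <= j < N) a ^+ j) * f0 = 0 <->
  exists w1 w2, f0 = 2 ^+ (r - eta) * w1 /\ g = 2 ^+ (eta - u) * w2.
Proof.
have le_er : (eta <= r)%N by lia.
have [w ->] : exists w : I, \sum_(0 <= j < N) a ^+ j = 2 ^+ eta * (1 + 2 * w).
  have [w wE] := sumX_1mod4 (2 ^+ (r - eta - 2) * (2 ^+ u * s%:R) : I) eta.
  exists w; rewrite -wE aE; apply: eq_bigr => j _; congr ((1 + _) ^+ _).
  rewrite -[in LHS](@subnKC 2 (r - eta)) ?exprD; last by lia.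
  by ring.
split=> [[fg]|[w1 [w2 [-> ->]]]]; last first.
  rewrite aE; split; last first.
    by rewrite mulrAC !mulrA -exprD subnKC // expr2_Z2_eq0 // !mul0r.
  rewrite mulrA -exprD subnKC // (expr2_Z2_eq0 r_gt0 (leqnn r)) mul0r.
  apply/esym; rewrite opprD addNKr mulNr.
  rewrite (_ : _ * _ * (_ * _) = 2 ^+ (r - eta + u + (eta - u)) * (s%:R * w2));
    last first.
    by rewrite !exprD; ring.
  by rewrite expr2_Z2_eq0 ?mul0r ?oppr0 //; lia.
rewrite [2 ^+ _ * _]mulrC -mulrA => /eqP;
  rewrite (mulrI_eq0 _ (mulrI (unit_1D2 r_gt0 _))) => /eqP f0N.
have [w1 f0E] := mulX2_eq0 r_gt0 le_er f0N.
exists w1; rewrite f0E.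
have [w2 ->] : exists w2, g = 2 ^+ (eta - u) * w2; last by exists w2.
case/orP: s_odd => [odd_s|/eqP->]; last by exists g; rewrite subnn mul1r.
have le_i : (r - eta + u <= r)%N by lia.
have -> : (eta - u = r - (r - eta + u))%N by lia.
apply: mulX2_eq0 => //; apply/eqP;
  rewrite -(mulrI_eq0 _ (mulrI (odd_unit_Z2 r_gt0 odd_s))).
move: fg; rewrite f0N aE opprD addNKr => /esym/eqP.
by rewrite mulNr oppr_eq0 exprD; congr (_ == _); ring.
Qed.

(** Write f0 = 2^(r-eta) w1 and g = 2^(eta-u) w2. Then w1 counts modulo 2^eta, w2 modulo
    2^(r+u-eta), and coboundaries shift (w1, w2) by 2^u t (-s, 1). The modulus of w2 is the larger
    one, so w2 is reduced below 2^u first; a shift that fixes w2 also fixes w1. *)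
Lemma parametrizes_plus_big : (2 * eta < r + u)%N ->
  parametrizes d [set (2 ^+ (r - eta) * ((val z1)%:R - s%:R * (val z2)%:R),
                       2 ^+ (eta - u) * (val z2)%:R)
                   | z1 : 'I_(2 ^ eta), z2 : 'I_(2 ^ u)].
Proof.
move=> big_u.
have a1 : 1 - a = - (2 ^+ (r - eta) * (2 ^+ u * s%:R)) by rewrite aE; ring.
have eta0 (y : I) : 2 ^+ (r - eta) * (2 ^+ eta * y) = 0.
  by rewrite mulrA -exprD expr2_Z2_eq0 ?mul0r //; lia.
have uE (y : I) : 2 ^+ eta * y = 2 ^+ (eta - u) * (2 ^+ u * y).
  by rewrite [RHS]mulrA -exprD subnK.
apply: parametrizes_mulI => [f0 g|f0 g fg fS|f0 g f1 g'].
- case/imset2P=> z1 z2 _ _ [-> ->]; apply/plus_condP.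
  by exists ((val z1)%:R - s%:R * (val z2)%:R), (val z2)%:R.
- have /plus_condP[w1 [w2 [-> ->]]] := conj fg fS.
  have [q [z2 [lt_z2 w2E]]] := divX2 u w2.
  (* The shift by t = -q turns w1 into w1 + 2^u s q. As the set writes this coordinate as z1 - s z2,
     the term s z2 is added before reducing. *)
  have [q' [z1 [lt_z1 w1E]]] := divX2 eta (w1 + 2 ^+ u * s%:R * q%:R + s%:R *
    z2%:R).
  exists (- q%:R); apply/imset2P.
  exists (Ordinal lt_z1) (Ordinal lt_z2); rewrite ?inE //=; congr (_, _).
    rewrite -[z1%:R](addrK (2 ^+ eta * q'%:R)) -w1E a1.
    rewrite ![in RHS](mulrDr (2 ^+ (r - eta))) [in RHS](mulrN _ (2 ^+ eta * _))
      eta0.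
    by ring.
  by rewrite uE w2E; ring.
- case/imset2P=> z1 z2 _ _ [-> ->]; case/imset2P=> z1' z2' _ _ [-> ->] t tf tg.
  have [w wE] : exists w : I, (val z2)%:R - (val z2')%:R - 2 ^+ u * t
      = 2 ^+ (r - (eta - u)) * w.
    by apply: mulX2_eq0 => //; [lia | rewrite !mulrBr tg -uE; ring].
  have z2E : val z2 = val z2'.
    apply: (@natr_inj_modX2 _ r_gt0 u _ _ (t + 2 ^+ (r - eta) * w) _ (ltn_ord
      z2) (ltn_ord z2')); first by lia.
    rewrite (_ : r - (eta - u) = u + (r - eta))%N in wE; last by lia.
    rewrite mulrDr [_ * (_ * w)]mulrA -exprD -wE; ring.
  have [w' tE] : exists w' : I, t = 2 ^+ (r - eta) * w'.
    apply: mulX2_eq0 => //; first by lia.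
    by move: tg; rewrite z2E -[LHS]addr0 => /addrI.
  have [w1 w1E] : exists w1 : I, (val z1)%:R - (val z1')%:R = 2 ^+ (r - (r -
    eta)) * w1.
    apply: mulX2_eq0 => //; first by lia.
    (* The inequality [2 * eta < r + u] gives 2 (r - eta) + u >= r. *)
    have X0 : 2 ^+ (r - eta) * 2 ^+ u * 2 ^+ (r - eta) = 0 :> I.
      by rewrite -!exprD expr2_Z2_eq0 //; lia.
    have E : (1 - a) * t = 0.
      by rewrite a1 tE -[RHS](mulr0 (- (s%:R * w'))) -X0; ring.
    move: tf; rewrite E addr0 z2E !mulrBr => /addIr ->.
    by rewrite subrr.
  have z1E : val z1 = val z1'.
    apply: (@natr_inj_modX2 _ r_gt0 eta _ _ w1 _ (ltn_ord z1) (ltn_ord z1'));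
      first by lia.
    by rewrite subKn in w1E; [rewrite -w1E addrC subrK | lia].
  by rewrite z1E z2E.
Qed.

(** Same coordinates and shifts as in [parametrizes_plus_big], but the modulus of w1 is now at least
    that of w2. So w1 / s is reduced below 2^u first, and a shift that fixes w1 also fixes w2. *)
Lemma parametrizes_plus_small : odd s -> (r + u <= 2 * eta)%N ->
  parametrizes d [set (2 ^+ (r - eta) * s%:R * (val z1)%:R,
                       2 ^+ (eta - u) * ((val z2)%:R - (val z1)%:R))
                   | z1 : 'I_(2 ^ u), z2 : 'I_(2 ^ (r + u - eta))].
Proof.
move=> odd_s small_u.
have us := odd_unit_Z2 r_gt0 odd_s.
have a1 : 1 - a = - (2 ^+ (r - eta) * (2 ^+ u * s%:R)) by rewrite aE; ring.
have u0 (y : I) : 2 ^+ (eta - u) * (2 ^+ (r + u - eta) * y) = 0.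
  by rewrite mulrA -exprD expr2_Z2_eq0 ?mul0r //; lia.
have uE (y : I) : 2 ^+ eta * y = 2 ^+ (eta - u) * (2 ^+ u * y).
  by rewrite [RHS]mulrA -exprD subnK.
apply: parametrizes_mulI => [f0 g|f0 g fg fS|f0 g f1 g'].
- case/imset2P=> z1 z2 _ _ [-> ->]; apply/plus_condP.
  by exists (s%:R * (val z1)%:R), ((val z2)%:R - (val z1)%:R); rewrite mulrA.
- have /plus_condP[w1 [w2 [-> ->]]] := conj fg fS.
  have [q [z1 [lt_z1 w1E]]] := divX2 u (s%:R^-1 * w1).
  (* The shift by t = q turns w2 into w2 + 2^u q, which the set writes as z2 - z1. *)
  have [q' [z2 [lt_z2 w2E]]] := divX2 (r + u - eta) (w2 + 2 ^+ u * q%:R +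
    z1%:R).
  exists q%:R; apply/imset2P.
  exists (Ordinal lt_z1) (Ordinal lt_z2); rewrite ?inE //=; congr (_, _).
    rewrite a1 -[w1](mulVKr us) w1E; ring.
  rewrite -[z2%:R](addrK (2 ^+ (r + u - eta) * q'%:R)) -w2E uE.
  rewrite [in RHS]addrAC addrK mulrBr u0 subr0; ring.
- case/imset2P=> z1 z2 _ _ [-> ->]; case/imset2P=> z1' z2' _ _ [-> ->] t tf tg.
  have [w wE] : exists w : I, s%:R * ((val z1)%:R - (val z1')%:R + 2 ^+ u * t)
      = 2 ^+ (r - (r - eta)) * w.
    apply: mulX2_eq0 => //; first by lia.
    by rewrite mulrA mulrDr mulrBr tf a1; ring.
  rewrite subKn in wE; last by lia.
  have z1E : val z1 = val z1'.
    apply: (@natr_inj_modX2 _ r_gt0 u _ _ (2 ^+ (eta - u) * (s%:R^-1 * w) - t)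
      _ (ltn_ord z1) (ltn_ord z1')); first by lia.
    rewrite mulrBr [2 ^+ u * (_ * _)]mulrA -exprD subnKC // mulrCA -wE mulKr //.
    by ring.
  have [w' tE] : exists w' : I, t = 2 ^+ (r - (r - eta + u)) * w'.
    apply: mulX2_eq0 => //; first by lia.
    apply/eqP; rewrite -(mulrI_eq0 _ (mulrI us)) -oppr_eq0; apply/eqP.
    move: tf; rewrite z1E -[LHS]addr0 => /addrI ->.
    by rewrite a1 exprD; ring.
  have [w2 w2E] : exists w2 : I, (val z2)%:R - (val z2')%:R - 2 ^+ u * t
      = 2 ^+ (r - (eta - u)) * w2.
    apply: mulX2_eq0 => //; first by lia.
    rewrite mulrBr -uE; move/eqP: tg; rewrite z1E -subr_eq0 => /eqP <-.
    by ring.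
  have z2E : val z2 = val z2'.
    (* 2^u t = 2^eta w', a multiple of 2^(r+u-eta) because r + u <= 2 eta. *)
    apply: (@natr_inj_modX2 _ r_gt0 (r + u - eta) _ _
      (2 ^+ (2 * eta - (r + u)) * w' + w2) _ (ltn_ord z2) (ltn_ord z2'));
        first by lia.
    rewrite mulrDr mulrA -exprD.
    rewrite (_ : r - (eta - u) = r + u - eta)%N in w2E; last by lia.
    rewrite (_ : r - (r - eta + u) = eta - u)%N in tE; last by lia.
    rewrite -w2E tE mulrA -exprD (_ : r + u - eta + _ = u + (eta - u))%N;
      last by lia.
    by ring.
  by rewrite z1E z2E.
Qed.

End Plus.

End Action.

(** * Closed forms for the powers and the geometric sums *)

Lemma expr1D_bin (R : comPzRingType) (x : R) n :
  (1 + x) ^+ n = \sum_(0 <= i < n.+1) 'C(n, i)%:R * x ^+ i.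
Proof.
rewrite exprDn big_mkord; apply: eq_bigr => i _.
by rewrite expr1n mul1r mulr_natl.
Qed.

(** Induction on n by Pascal's rule. *)
Lemma sumX_1D_bin (R : comPzRingType) (x : R) n :
  \sum_(0 <= j < n) (1 + x) ^+ j = \sum_(0 <= l < n) 'C(n, l.+1)%:R * x ^+ l.
Proof.
elim: n => [|n IH]; first by rewrite !big_nil.
rewrite big_nat_recr //= IH expr1D_bin.
under [RHS]eq_bigr => l _ do rewrite binS natrD mulrDl.
by rewrite big_split /= [X in _ = X + _]big_nat_recr //= bin_small // mul0r
  addr0.
Qed.

Lemma sumX_N1D_bin (R : comPzRingType) (x : R) n :
  \sum_(0 <= j < n) (- (1 + x)) ^+ j =
  \sum_(0 <= l < n) (\sum_(l <= j < n) (-1) ^+ j * 'C(j, l)%:R) * x ^+ l.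
Proof.
elim: n => [|n IH]; first by rewrite !big_nil.
rewrite big_nat_recr //= IH exprNn expr1D_bin mulr_sumr.
under [RHS]eq_big_nat => l /andP[_ lt_l].
  rewrite big_nat_recr //= mulrDl -mulrA; over.
by rewrite big_split /= [X in _ = X + _]big_nat_recr //= [\sum_(n <= _ < n)
  _]big_geq // mul0r addr0.
Qed.

(** Only the linear term of the binomial expansion survives. This serves the case r + u > 2 eta,
    where 2^(r-eta) k has square zero. *)
Lemma expr1D_sqr0 (R : comPzRingType) (x : R) n : x ^+ 2 = 0 ->
  (1 + x) ^+ n = 1 + x * n%:R.
Proof.
move=> x2; elim: n => [|n IH]; first by rewrite mulr0 addr0.
rewrite exprS IH -natr1 -[RHS]addr0 -(mulr0 n%:R) -x2; ring.
Qed.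

(** The correction [m] stays unspecified because the sum will be multiplied by an [f0] with x f0 =
    0. *)
Lemma sumX_1D_sqr0 (R : comPzRingType) (x : R) n : x ^+ 2 = 0 ->
  exists m, \sum_(0 <= j < n) (1 + x) ^+ j = n%:R + x * m.
Proof.
move=> x2; elim: n => [|n [m IH]]; first by exists 0;
  rewrite big_nil mulr0 addr0.
exists (m + n%:R); rewrite big_nat_recr //= IH expr1D_sqr0 // -natr1; ring.
Qed.

(** The terms are (-1)^j (1 + j x), and each pair of consecutive ones adds up to -x. For odd n the
    last term 1 + (n - 1) x is left over. *)
Lemma sumX_N1D_sqr0 (R : comPzRingType) (x : R) n : x ^+ 2 = 0 ->
  \sum_(0 <= j < n) (- (1 + x)) ^+ j =
  if odd n then 1 + x * (n./2)%:R else - (x * (n./2)%:R).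
Proof.
move=> x2; elim: n => [|n IH]; first by rewrite big_nil mulr0 oppr0.
rewrite big_nat_recr //= IH exprNn expr1D_sqr0 // uphalf_half -signr_odd.
have -> : n%:R = (odd n)%:R + 2 * (n./2)%:R :> R.
  by rewrite -natrM -natrD mul2n odd_double_half.
by rewrite natrD; case: (odd n) => /=; ring.
Qed.

(** * The action is by powers of a root of unity, and the shape of such a root *)

Section Shape.

Variables (eta r : nat) (eta_gt0 : (0 < eta)%N) (lt_eta : (eta + 1 < r)%N).
Local Notation H := 'Z_(2 ^ eta).
Local Notation I := 'Z_(2 ^ r).
Local Notation N := (2 ^ eta)%N.

(** [I] is generated by 1, so an additive map is multiplication by the image of 1; [H] is generated
    by 1 as well. *)
Lemma zact_is_expr (d : zaction H I) (h : H) (y : I) : d h y = d 1 1 ^+ h * y.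
Proof.
have linE (g : H) (z : I) : d g z = d g 1 * z.
  by rewrite -[in LHS](natr_Z2 z) zactMn -mulr_natr natr_Z2.
rewrite linE -[in LHS](natr_Z2 h); congr (_ * _) => /=.
elim: (nat_of_ord h) => [|n IH]; first by rewrite zact0.
by rewrite -natr1 addrC zactD linE IH -exprS.
Qed.

Lemma root_unity_shape (a : I) : a ^+ N = 1 ->
  exists k : nat, (k < N)%N /\
    (a = 1 + 2 ^+ (r - eta) * k%:R \/ a = - (1 + 2 ^+ (r - eta) * k%:R)).
Proof.
have r_gt0 : (0 < r)%N by lia.
have le_er : (eta <= r)%N by lia.
have shape1 (y : I) : (1 + 4 * y) ^+ N = 1 ->
    exists k : nat, (k < N)%N /\ 1 + 4 * y = 1 + 2 ^+ (r - eta) * k%:R.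
  move=> y1; have [w wE] := sumX_1mod4 y eta.
  have := subrX1 (1 + 4 * y) N;
    rewrite y1 subrr -(big_mkord predT (fun j => (1 + 4 * y) ^+ j)) wE.
  rewrite [1 + _]addrC addrK mulrA mulrC => /esym/eqP.
  rewrite (mulrI_eq0 _ (mulrI (unit_1D2 r_gt0 _))) mulrC => /eqP /(mulX2_eq0
    r_gt0 le_er)[v ->].
  have [q [k [lt_k ->]]] := divX2 eta v; exists k; split=> //.
  rewrite [RHS]addrC; congr (_ + 1).
  by rewrite mulrDr [X in _ + X]mulrA -exprD subnK // (expr2_Z2_eq0 r_gt0
    (leqnn r)) mul0r addr0.
move=> a1.
have a_odd : odd (val a).
  have /unitrPr : exists b, a * b = 1.
    by exists (a ^+ N.-1); rewrite -exprS prednK ?expn_gt0.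
  by rewrite -{1}(natr_Z2 a) unitZpE ?Zp2_gt1 // coprime_pexpl // coprime2n.
have [q aE] : exists q, val a = (1 + 4 * q)%N \/ val a = (3 + 4 * q)%N.
  by exists (val a %/ 4)%N; move: (val a) a_odd => n; lia.
case: aE => valE; have {valE} := congr1 (fun n => n%:R : I) valE;
  rewrite natr_Z2 natrD natrM => aE.
  have [|k [lt_k kE]] := shape1 q%:R; first by rewrite -aE.
  by exists k; split=> //; left; rewrite aE kE.
(* The residue 3 modulo 4 is brought to the residue 1 by a change of sign, which leaves the N-th
   power unchanged because N is even. *)
have {}aE : a = - (1 + 4 * - (1 + q%:R)) by rewrite aE; ring.
have [|k [lt_k kE]] := shape1 (- (1 + q%:R)).
  by rewrite -[1 + _]opprK -aE exprNn -signr_odd oddX eqn0Ngt eta_gt0 mul1r.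
by exists k; split=> //; right; rewrite aE kE.
Qed.

End Shape.

(** * Assembly of the cases *)

Lemma binom_termE (R : comPzRingType) (c x y : R) m i :
  c * x ^+ (m * i) * y ^+ i = c * (x ^+ m * y) ^+ i.
Proof. by rewrite exprMn -exprM mulrA. Qed.

Theorem proposition4p8 (eta r : nat) (heta : (1 <= eta)%N)
    (hr : (eta + 1 < r)%N) (d : zaction 'Z_(2 ^ eta) 'Z_(2 ^ r)) :
  (exists (k : nat) (a : 'Z_(2 ^ r)),
     [/\ (k < 2 ^ eta)%N,
         a = 1 + 2 ^+ (r - eta) * k%:R \/ a = - (1 + 2 ^+ (r - eta) * k%:R)
       & forall (h : 'Z_(2 ^ eta)) (y : 'Z_(2 ^ r)), d h y = a ^+ h * y]) /\
  (forall (k : nat) (a : 'Z_(2 ^ r)),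
     (k < 2 ^ eta)%N ->
     a = 1 + 2 ^+ (r - eta) * k%:R \/ a = - (1 + 2 ^+ (r - eta) * k%:R) ->
     (forall (h : 'Z_(2 ^ eta)) (y : 'Z_(2 ^ r)), d h y = a ^+ h * y) ->
   [/\
     (* k = 0 and a = 1 *)
     k = 0%N -> a = 1 ->
     let L : {set 'Z_(2 ^ r) * 'Z_(2 ^ r)} :=
       [set (2 ^+ (r - eta) * (val z1)%:R, (val z2)%:R)
         | z1 : 'I_(2 ^ eta), z2 : 'I_(2 ^ eta)] in
     [/\ parametrizes d L,
         forall (h : 'Z_(2 ^ eta)) (y : 'Z_(2 ^ r)), d h y = y
       & forall f0 gamma : 'Z_(2 ^ r), (f0, gamma) \in L ->
         forall h h' : 'Z_(2 ^ eta),
           fcocycle d f0 (h, h') = f0 * (val h)%:R * (val h')%:R],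

     (* k = 0 and a = -1 *)
     k = 0%N -> a = -1 ->
     let L : {set 'Z_(2 ^ r) * 'Z_(2 ^ r)} :=
       [set ((val z1)%:R,
             2 ^+ (r - 1) * (val z2)%:R + 2 ^+ (eta - 1) * (val z1)%:R)
         | z1 : 'I_2, z2 : 'I_2] in
     [/\ parametrizes d L,
         forall (h : 'Z_(2 ^ eta)) (y : 'Z_(2 ^ r)), d h y = (-1) ^+ h * y
       & forall f0 gamma : 'Z_(2 ^ r), (f0, gamma) \in L ->
         forall h h' : 'Z_(2 ^ eta),
           fcocycle d f0 (h, h') =
             if odd (val h) then f0 * (val h')%:R else 0],

     (* k <> 0 and r + u > 2 eta *)
     k <> 0%N -> forall u s : nat, k = (2 ^ u * s)%N -> (u < eta)%N ->
     ~~ (2 %| s)%N -> (2 * eta < r + u)%N ->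
     [/\ a = 1 + 2 ^+ (r - eta) * k%:R ->
         let L : {set 'Z_(2 ^ r) * 'Z_(2 ^ r)} :=
           [set (2 ^+ (r - eta) * ((val z1)%:R - s%:R * (val z2)%:R),
                 2 ^+ (eta - u) * (val z2)%:R)
             | z1 : 'I_(2 ^ eta), z2 : 'I_(2 ^ u)] in
         [/\ parametrizes d L,
             forall (h : 'Z_(2 ^ eta)) (y : 'Z_(2 ^ r)),
               d h y = (1 + 2 ^+ (r - eta) * k%:R * (val h)%:R) * y
           & forall f0 gamma : 'Z_(2 ^ r), (f0, gamma) \in L ->
             forall h h' : 'Z_(2 ^ eta),
               fcocycle d f0 (h, h') = f0 * (val h)%:R * (val h')%:R],

         a = -1 - 2 ^+ (r - eta) * k%:R -> (2 %| k)%N ->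
         let F0 (z1 : nat) : 'Z_(2 ^ r) :=
           z1%:R + 2 ^+ (r - eta - 1) * k%:R * z1%:R in
         let L : {set 'Z_(2 ^ r) * 'Z_(2 ^ r)} :=
           [set (F0 (val z1),
                 2 ^+ (r - 1) * (val z2)%:R + 2 ^+ (eta - 1) * (val z1)%:R)
             | z1 : 'I_2, z2 : 'I_2] in
         [/\ parametrizes d L,
             forall (h : 'Z_(2 ^ eta)) (y : 'Z_(2 ^ r)),
               d h y =
                 (-1) ^+ h * (1 + 2 ^+ (r - eta) * k%:R * (val h)%:R) * y
           & forall (z1 : 'I_2) (h h' : 'Z_(2 ^ eta)),
               fcocycle d (F0 (val z1)) (h, h') =
                 if odd (val h)
                 then (val z1)%:R * (val h')%:R
                      + 2 ^+ (r - eta - 1) * k%:R * (val z1)%:R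
                        * (val h)%:R * (val h')%:R
                 else - (k%:R * 2 ^+ (r - eta - 1) * (val z1)%:R
                         * (val h)%:R * (val h')%:R)]
       & a = -1 - 2 ^+ (r - eta) * k%:R -> ~~ (2 %| k)%N ->
         let L : {set 'Z_(2 ^ r) * 'Z_(2 ^ r)} :=
           [set (0, 2 ^+ (r - 1) * (val z2)%:R) | z2 : 'I_2] in
         [/\ parametrizes d L,
             forall (h : 'Z_(2 ^ eta)) (y : 'Z_(2 ^ r)),
               d h y =
                 (-1) ^+ h * (1 + 2 ^+ (r - eta) * k%:R * (val h)%:R) * y
           & forall f0 gamma : 'Z_(2 ^ r), (f0, gamma) \in L ->
             forall h h' : 'Z_(2 ^ eta), fcocycle d f0 (h, h') = 0]]

   & (* k <> 0 and r + u <= 2 eta *)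
     k <> 0%N -> forall u s : nat, k = (2 ^ u * s)%N -> (u < eta)%N ->
     ~~ (2 %| s)%N -> (r + u <= 2 * eta)%N ->
     [/\ a = 1 + 2 ^+ (r - eta) * k%:R ->
         let L : {set 'Z_(2 ^ r) * 'Z_(2 ^ r)} :=
           [set (2 ^+ (r - eta) * s%:R * (val z1)%:R,
                 2 ^+ (eta - u) * ((val z2)%:R - (val z1)%:R))
             | z1 : 'I_(2 ^ u), z2 : 'I_(2 ^ (r + u - eta))] in
         [/\ parametrizes d L,
             forall (h : 'Z_(2 ^ eta)) (y : 'Z_(2 ^ r)),
               d h y =
                 \sum_(0 <= i < (val h).+1)
                   'C(val h, i)%:R * 2 ^+ ((r - eta) * i) * k%:R ^+ i * y
           & forall f0 gamma : 'Z_(2 ^ r), (f0, gamma) \in L ->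
             forall h h' : 'Z_(2 ^ eta),
               fcocycle d f0 (h, h') =
                 \sum_(0 <= l < val h)
                   'C(val h, l.+1)%:R * 2 ^+ ((r - eta) * l) * k%:R ^+ l
                   * f0 * (val h')%:R],

         a = -1 - 2 ^+ (r - eta) * k%:R -> ~~ (2 %| k)%N ->
         let L : {set 'Z_(2 ^ r) * 'Z_(2 ^ r)} :=
           [set (0, 2 ^+ (r - 1) * (val z2)%:R) | z2 : 'I_2] in
         [/\ parametrizes d L,
             forall (h : 'Z_(2 ^ eta)) (y : 'Z_(2 ^ r)),
               d h y =
                 (-1) ^+ h *
                 \sum_(0 <= i < (val h).+1)
                   'C(val h, i)%:R * 2 ^+ ((r - eta) * i) * k%:R ^+ i * y
           & forall f0 gamma : 'Z_(2 ^ r), (f0, gamma) \in L ->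
             forall h h' : 'Z_(2 ^ eta), fcocycle d f0 (h, h') = 0]
       & a = -1 - 2 ^+ (r - eta) * k%:R -> (2 %| k)%N ->
         let c : 'Z_(2 ^ r) := 1 - 2 ^+ (r - eta - 1) * k%:R in
         let A (h l : nat) : 'Z_(2 ^ r) :=
           \sum_(l <= j < h) (-1) ^+ j * 'C(j, l)%:R in
         let L : {set 'Z_(2 ^ r) * 'Z_(2 ^ r)} :=
           [set ((val z1)%:R,
                 2 ^+ (r - 1) * (val z2)%:R
                 + 2 ^+ (eta - 1) * c * (val z1)%:R)
             | z1 : 'I_2, z2 : 'I_2] in
         [/\ parametrizes d L,
             forall (h : 'Z_(2 ^ eta)) (y : 'Z_(2 ^ r)),
               d h y =
                 (-1) ^+ h *
                 \sum_(0 <= i < (val h).+1)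
                   'C(val h, i)%:R * 2 ^+ ((r - eta) * i) * k%:R ^+ i * y
           & forall f0 gamma : 'Z_(2 ^ r), (f0, gamma) \in L ->
             forall h h' : 'Z_(2 ^ eta),
               fcocycle d f0 (h, h') =
                 \sum_(0 <= l < val h)
                   A (val h) l * 2 ^+ ((r - eta) * l) * k%:R ^+ l
                   * f0 * (val h')%:R]]]).
Proof.
have r_gt0 : (0 < r)%N by lia.
split.
  have a1 : d 1 1 ^+ (2 ^ eta)%N = 1 by apply: (expr_base heta (zact_is_expr
    d)).
  have [k [lt_k aE]] := root_unity_shape heta hr a1.
  by exists k, (d 1 1); split=> // h y; apply: zact_is_expr.
move=> k a lt_k _ dE.
(* [a] is 1 + X or -(1 + X). The lemmas for the sign minus are stated in terms of the half x of X,
   which is still even because r > eta + 1. *)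
pose X : 'Z_(2 ^ r) := 2 ^+ (r - eta) * k%:R.
pose x : 'Z_(2 ^ r) := 2 ^+ (r - eta - 1) * k%:R.
have XE : X = 2 * x.
  by rewrite /X /x mulrA -exprS -subSn ?subSS ?subn0 //; lia.
have ux : (1 + x) \is a GRing.unit.
  rewrite /x (_ : r - eta - 1 = (r - eta - 2).+1)%N; last by lia.
  by rewrite exprS -mulrA unit_1D2.
have NaE : a = -1 - X -> a = - (1 + 2 * x) by rewrite XE opprD.
have x_even : (2 %| k)%N -> x *+ 2 ^ eta = 0.
  move=> /dvdnP[m kE]; rewrite -mulr_natl natrX /x kE natrM.
  rewrite (_ : _ * _ = 2 ^+ (eta + (r - eta - 1) + 1) * m%:R);
    last by rewrite !exprD; ring.
  by rewrite expr2_Z2_eq0 ?mul0r //; lia.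
(* Writing k = 1 + 2 m, the contribution of 2 m is a multiple of 2^r. *)
have x_odd : ~~ (2 %| k)%N -> 2 ^+ eta * x = 2 ^+ (r - 1).
  rewrite dvdn2 negbK => k_odd;
    rewrite /x mulrA -exprD -(odd_double_half k) k_odd.
  rewrite -muln2 natrD natrM mulrDr mulr1 mulrCA [2 ^+ _ * 2]mulrC.
  rewrite (_ : eta + (r - eta - 1) = r - 1)%N; last by lia.
  by rewrite -exprS [2 ^+ _.+1]expr2_Z2_eq0 ?mulr0 ?addr0 //; lia.
have actP (h : 'Z_(2 ^ eta)) (y : 'Z_(2 ^ r)) : (1 + X) ^+ h * y =
    \sum_(0 <= i < (val h).+1) 'C(val h, i)%:R * 2 ^+ ((r - eta) * i) * k%:R ^+
      i * y.
  rewrite expr1D_bin mulr_suml; apply: eq_bigr => i _.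
  by rewrite binom_termE.
have actN : a = -1 - X -> forall (h : 'Z_(2 ^ eta)) (y : 'Z_(2 ^ r)), d h y =
    (-1) ^+ h * \sum_(0 <= i < (val h).+1) 'C(val h, i)%:R * 2 ^+ ((r - eta) *
      i) * k%:R ^+ i * y.
  by move=> aE h y; rewrite dE aE -opprD [(- (1 + X)) ^+ _]exprNn -mulrA actP.
have fE := fcocycle_mulE heta dE.
have fc0 (h h' : 'Z_(2 ^ eta)) : fcocycle d 0 (h, h') = 0 by rewrite fE mulr0
  mul0r.
have minus_odd : a = -1 - X -> ~~ (2 %| k)%N ->
    parametrizes d [set (0, 2 ^+ (r - 1) * (val z2)%:R) | z2 : 'I_2].
  by move=> /NaE aE k_odd;
    apply: (parametrizes_minus_odd heta hr dE aE) => //; apply: x_odd.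
split.
- move=> k0 a1 L; split.
  (* The trivial action is the instance u = eta, s = 0 of [parametrizes_plus_big]. *)
  + have -> : L = [set (2 ^+ (r - eta) * ((val z1)%:R - 0%:R * (val z2)%:R),
                       2 ^+ (eta - eta) * (val z2)%:R)
                   | z1 : 'I_(2 ^ eta), z2 : 'I_(2 ^ eta)].
      by apply: eq_in_imset2 => z1 z2 _ _; rewrite mul0r subr0 subnn mul1r.
    apply: (parametrizes_plus_big heta hr dE (leqnn eta)).
    * by rewrite eqxx orbT.
    * by rewrite a1 !mulr0 addr0.
    * by lia.
  + by move=> h y; rewrite dE a1 expr1n mul1r.
  + move=> f0 g _ h h'; rewrite fE a1.
    under eq_bigr => j _ do rewrite expr1n.
    by rewrite big_const_nat subn0 iter_addr_0 [f0 * _]mulrC.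
- move=> k0 aN1 L.
  have aE : a = - (1 + 2 * x) by rewrite aN1 /x k0 !mulr0 addr0.
  split.
  + apply: (parametrizes_minus_even heta hr dE aE (F := fun z => z%:R)
      (G := fun z => 2 ^+ (eta - 1) * z%:R)) => //.
    * by rewrite /x k0 mulr0 mul0rn.
    * by move=> z; exists 0; rewrite mulr0 addr0.
    * move=> z _; rewrite aN1 opprK mulrA -exprS -subSn // subSS subn0 //.
  + by move=> h y; rewrite dE aN1.
  + move=> f0 g _ h h'; rewrite fE aN1.
    have := @sumX_N1D_sqr0 _ (0 : 'Z_(2 ^ r)) (val h) (expr0n _ _).
    rewrite addr0 => ->; rewrite !mul0r addr0 oppr0.
    by case: odd; rewrite ?mul1r ?mul0r.
- move=> k_neq0 u s kE lt_u s_odd big_u.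
  have {}s_odd : odd s by rewrite -[odd s]negbK -dvdn2.
  have kRE : k%:R = 2 ^+ u * s%:R :> 'Z_(2 ^ r) by rewrite kE natrM natrX.
  have X20 : X ^+ 2 = 0.
    rewrite /X kRE (_ : _ ^+ 2 = 2 ^+ ((r - eta) + u + (r - eta) + u) * s%:R ^+
      2); last first.
      by rewrite !exprD; ring.
    by rewrite expr2_Z2_eq0 ?mul0r //; lia.
  (* Compared with X^2 one factor 2 is lost; the strict inequality 2 eta < r + u absorbs it. *)
  have x20 : 2 * x ^+ 2 = 0.
    rewrite /x kRE (_ : _ * _ ^+ 2 = 2 ^+ ((r - eta - 1) + u + (r - eta - 1) +
      u + 1) * s%:R ^+ 2); last first.
      by rewrite !exprD; ring.
    by rewrite expr2_Z2_eq0 ?mul0r //; lia.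
  have actN0 : a = -1 - X -> forall (h : 'Z_(2 ^ eta)) (y : 'Z_(2 ^ r)), d h y =
      (-1) ^+ h * (1 + 2 ^+ (r - eta) * k%:R * (val h)%:R) * y.
    by move=> aE h y; rewrite dE aE -opprD [(- (1 + X)) ^+ _]exprNn expr1D_sqr0.
  split=> [aE L|aE k_even F0 L|aE k_odd L].
  + split.
    * apply: (parametrizes_plus_big heta hr dE (ltnW lt_u)) => //.
        by rewrite s_odd.
      by rewrite aE kRE.
    * by move=> h y; rewrite dE aE expr1D_sqr0.
    * move=> f0 g /imset2P[z1 z2 _ _ [-> _]] h h'.
      rewrite fE aE -/X; have [m ->] := sumX_1D_sqr0 (val h) X20.
      set w := _ - _;
        rewrite (_ : (_ + _) * _ = 2 ^+ (r - eta) * w * (val h)%:R) //.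
      rewrite [LHS]mulrDl [X in X + _]mulrC /X kRE.
      rewrite (_ : 2 ^+ (r - eta) * (2 ^+ u * s%:R) * m * (2 ^+ (r - eta) * w)
        = 2 ^+ ((r - eta) + u + (r - eta)) * (s%:R * m * w)); last first.
        by rewrite !exprD; ring.
      by rewrite [2 ^+ (_ + _ + _)]expr2_Z2_eq0 ?mul0r ?addr0 //; lia.
  + split.
    * apply: (parametrizes_minus_even heta hr dE (NaE aE) (F := F0)
        (G := fun z => 2 ^+ (eta - 1) * z%:R)) => //.
      - exact: x_even.
      - move=> z; exists (2 ^+ (r - eta - 2) * k%:R * z%:R).
        rewrite /F0 (_ : r - eta - 1 = (r - eta - 2).+1)%N; last by lia.
        by rewrite exprS; ring.
      (* F0 z = (1 + x) z and 1 - a = 2 (1 + x), so both sides equal 2^eta (1 + x) z. *)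
      - move=> z _; rewrite (NaE aE) /F0 -/x.
        by rewrite -[in LHS](subnK heta) addn1 exprS; ring.
    * exact: actN0.
    * move=> z1 h h'; rewrite fE (NaE aE) -XE.
      rewrite (sumX_N1D_sqr0 _ X20) XE /F0 -/x [k%:R * _]mulrC -/x.
      have -> : (val h)%:R = (odd (val h))%:R + 2 * ((val h)./2)%:R :> 'Z_(2 ^
        r).
        by rewrite -natrM -natrD mul2n odd_double_half.
      set b := ((val h)./2)%:R.
      (* Once h is written as its parity plus 2 b, the two sides differ by this multiple of 2
         x^2. *)
      have E : 2 * x ^+ 2 * (b * (val z1)%:R * (val h')%:R) = 0 by rewrite x20
        mul0r.
      case: odd => /=; first by rewrite -[RHS]addr0 -E; ring.
      by rewrite -[RHS]subr0 -E; ring.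
  + split; [exact: minus_odd | exact: actN0 |].
    by move=> f0 g /imsetP[z _ [-> _]] h h'.
move=> k_neq0 u s kE lt_u s_odd small_u.
have {}s_odd : odd s by rewrite -[odd s]negbK -dvdn2.
have kRE : k%:R = 2 ^+ u * s%:R :> 'Z_(2 ^ r) by rewrite kE natrM natrX.
split=> [aE L|aE k_odd L|aE k_even c A L].
- split.
  + apply: (parametrizes_plus_small heta hr dE (ltnW lt_u)) => //.
      by rewrite s_odd.
    by rewrite aE kRE.
  + by move=> h y; rewrite dE aE actP.
  + move=> f0 g _ h h'; rewrite fE aE sumX_1D_bin !mulr_suml.
    by apply: eq_bigr => l _; rewrite binom_termE.
- split; [exact: minus_odd | exact: actN |].
  by move=> f0 g /imsetP[z _ [-> _]] h h'.
- split; last first.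
  + move=> f0 g _ h h'; rewrite fE aE -opprD sumX_N1D_bin !mulr_suml.
    by apply: eq_bigr => l _; rewrite binom_termE.
  + exact: actN.
  apply: (parametrizes_minus_even heta hr dE (NaE aE) (F := fun z => z%:R)
    (G := fun z => 2 ^+ (eta - 1) * c * z%:R)) => //.
  + exact: x_even.
  + by move=> z; exists 0; rewrite mulr0 addr0.
  move=> z _; rewrite (NaE aE) /c -/x -[in LHS](subnK heta) addn1 exprS.
  (* (1 - a) c = 2 (1 + x) (1 - x) = 2 - 2 x^2, so the error is 2^eta x^2 z. It vanishes because eta
     + 2 (r - eta - 1) >= r. *)
  have E : 2 ^+ (eta - 1) * 2 * x ^+ 2 = 0.
    rewrite /x exprMn -exprM mulrA -exprSr -exprD expr2_Z2_eq0 ?mul0r //; lia.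
  by rewrite -[LHS]subr0 -(mul0r z%:R) -E; ring.
Qed.
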